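(* Let $X$ be a real Hilbert space and let $A:X\to 2^X$ be a maximal monotone linear relation such that $\operatorname{dom}A$ is not closed, and let $V:=\overline{\operatorname{dom}A}$. Then for all $z\in\operatorname{dom}A$ the set $P_VAz$ is a singleton, and there is a sequence $(z_n)_{n\in\mathbb{N}}\subset\operatorname{dom}A$ such that for every $n\in\mathbb{N}$ $$(P_VA)^m(z_n)\in\operatorname{dom}A\quad\text{for all }1\le m<n,\qquad\text{and}\qquad (P_VA)^n(z_n)\notin\operatorname{dom}A.$$
   Context: $\mathbb{N}=\{1,2,3,\dots\}$. For a set-valued operator $T:X\to 2^X$: $\operatorname{dom}T=\{x:Tx\neq\emptyset\}$ and $\operatorname{gra}T=\{(x,x^* ):x^*\in Tx\}$. $T$ is monotone if $\langle x-y,x^*-y^*\rangle\ge0$ for all $(x,x^* ),(y,y^* )\in\operatorname{gra}T$; it is maximal monotone if it is monotone and its graph has no proper monotone extension. $A:X\to 2^X$ is a linear relation if $\operatorname{dom}A$ is a linear subspace of $X$ and, for all $x,y\in\operatorname{dom}A$ and $\lambda\in\mathbb{R}$, $\lambda Ax\subset A(\lambda x)$ and $Ax+Ay\subset A(x+y)$. $P_V$ is the orthogonal projection onto the closed subspace $V$, and $P_VAz=\{P_Vz^*:z^*\in Az\}$. Since $P_VAz$ is a singleton for $z\in\operatorname{dom}A$, it is identified with its unique element. $(P_VA)^m$ denotes the $m$-fold iterated composition of $P_VA$ with itself, e.g. $(P_VA)^3z=P_VA(P_VA(P_VAz))$. *)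

(* Defs.v *)
From HB Require Import structures.
From mathcomp Require Import all_boot all_order all_algebra.
From mathcomp Require Import all_classical all_reals all_analysis.

Set Implicit Arguments.
Unset Strict Implicit.
Unset Printing Implicit Defensive.
Import Order.TTheory GRing.Theory Num.Theory.
Import numFieldNormedType.Exports.
Local Open Scope classical_set_scope.
Local Open Scope ring_scope.

(* MathComp-Analysis has no Hilbert spaces.  A real Hilbert space is rendered as
   a complete normed module [X] over [R : realType] together with an inner
   product [ip : {dot X for idfun}] (symmetric, bilinear, positive definite)
   that induces the norm of [X]. *)

Section SetValuedOperators.
Context {R : realType} {X : completeNormedModType R}.
Variable ip : {dot X for idfun}.
Implicit Types (A B T : X -> set X) (V : set X).

Definition norm_of_inner : Prop := forall x : X, `|x| ^+ 2 = ip x x.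

Definition dom T : set X := [set x | T x !=set0].

Definition gra T : set (X * X) := [set p | T p.1 p.2].

Definition monotone T : Prop :=
  forall p q, gra T p -> gra T q -> 0 <= ip (p.1 - q.1) (p.2 - q.2).

Definition maximal_monotone T : Prop :=
  monotone T /\ forall B, monotone B -> gra T `<=` gra B -> gra B = gra T.

Definition linear_relation A : Prop :=
  [/\ submod_closed [in dom A],
      forall x (l : R), dom A x -> [set l *: u | u in A x] `<=` A (l *: x) &
      forall x y, dom A x -> dom A y ->
        [set u + v | u in A x & v in A y] `<=` A (x + y)].

(* The default value 0 of [xget] is never used when [V] is a closed subspace,
   the only case of interest: the projection then exists and is unique. *)
Definition orthproj V (x : X) : X :=
  xget 0 [set p | V p /\ forall v, V v -> ip (x - p) v = 0].

Definition proj_op V A : X -> set X := fun z => orthproj V @` A z.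

(* m-fold composition of set-valued operators:
   (T o S) z is the union of the sets T y for y in S z. *)
Definition op_iter T (m : nat) (z : X) : set X :=
  iter m (fun S : set X => \bigcup_(y in S) T y) [set z].

(* A singleton is identified with its element: for a set-valued expression [S]
   standing for a point, "S lies in D" means that [S] is a singleton whose
   element lies in [D]; use [~` D] to say that it lies outside [D]. *)
Definition value_in (S D : set X) : Prop := exists2 w, S = [set w] & D w.

End SetValuedOperators.

(* Main.v *)
Require Import Defs.
From HB Require Import structures.
From mathcomp Require Import all_boot all_order all_algebra.
From mathcomp Require Import all_classical all_reals all_analysis.
From mathcomp Require Import ring lra.
Import Order.TTheory GRing.Theory Num.Theory.
Import numFieldNormedType.Exports.
Local Open Scope classical_set_scope.
Local Open Scope ring_scope.

Set Implicit Arguments.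
Unset Strict Implicit.
Unset Printing Implicit Defensive.

(** Write [D] for the domain of [A], [V] for its closure, [P] for the
    orthogonal projection onto [V] and [T] for [P A].

    Two elements of [A z] differ by an element [u] of [A 0].  As [A 0] is a
    linear space, monotonicity between a point [(x, y)] of the graph and the
    points [(0, t u)] reads [<x, y> - t <x, u> >= 0] for all real [t], so [u]
    is orthogonal to [D] ([fiber0_orthogonal]).  Hence [P] takes one value on
    [A z], and [T] is a linear map from [D] to [V].

    The identity plus [T] maps [D] onto [V] ([resolvent_surj]), because the
    identity plus [A] is onto [X] ([minty]).  For a linear relation this
    surjectivity has a short proof: a vector [w] orthogonal to the range
    satisfies [<w, b> = - <w, a>] for [(a, b)] in the graph, which makes
    [(w, w)] monotonically related to the graph; by maximality [w] is in [A w],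
    so [w + w] is in the range and [w = 0] ([range_orthogonal0]).  The range is
    therefore dense, and it is closed because monotonicity bounds [|x - y|] by
    [|(x + u) - (y + v)|] for [(x, u)] and [(y, v)] in the graph.

    Since [D] is not closed, some [v] of [V] lies outside [D].  Apply to it [n]
    times a right inverse [J : V -> D] of the identity plus [T]: from
    [T J = 1 - J] one gets that [T^m J^n v] is a combination of
    [J^(n - m) v, ..., J^n v] in which [J^(n - m) v] has coefficient 1.  All
    these vectors lie in [D], except that the first one is [v] when [m = n].
    So the iterates of [J^n v] leave [D] exactly at step [n]
    ([exists_exit_time]). *)

(** * Nonnegative polynomial functions of degree at most two *)

Lemma affine_ge0_slope0 (R : realType) (a c : R) :
  (forall t, 0 <= c - t * a) -> a = 0.
Proof.
move=> h; apply/eqP/negPn/negP => a0.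
by have := h ((c + 1) / a); rewrite divfK //; lra.
Qed.

Lemma quadratic_ge0_slope0 (R : realType) (a b : R) : 0 <= b ->
  (forall t, 0 <= t ^+ 2 * b - 2 * t * a) -> a = 0.
Proof.
move=> b0 h; apply/eqP; rewrite -sqrf_eq0 eq_le sqr_ge0 andbT.
have b1 : 0 < b + 1 by lra.
(* The minimizer [a / b] of the quadratic, shifted to allow [b = 0]. *)
have := h (a / (b + 1)).
have -> : (a / (b + 1)) ^+ 2 * b - 2 * (a / (b + 1)) * a =
  - (a ^+ 2 * ((b + 2) / (b + 1) ^+ 2)) by field; rewrite gt_eqF.
rewrite oppr_ge0 pmulr_lle0 // divr_gt0 ?exprn_gt0 //; lra.
Qed.

(** * Iterates of a map whose shift by the identity is onto *)

Section Iterates.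
Variables (X : zmodType) (D V : set X) (T : X -> X).
Hypothesis DB : forall x y, D x -> D y -> D (x - y).
Hypothesis TB : forall x y, D x -> D y -> T (x - y) = T x - T y.
Hypothesis DV : D `<=` V.
Hypothesis surj : forall v, V v -> exists2 y, D y & y + T y = v.

Lemma iterB j x y :
  (forall i, (i < j)%N -> D (iter i T x)) ->
  (forall i, (i < j)%N -> D (iter i T y)) ->
  iter j T (x - y) = iter j T x - iter j T y.
Proof.
elim: j => //= j IH hx hy.
rewrite IH; first by apply: TB; [apply: hx|apply: hy].
  by move=> i ij; apply: hx; apply: ltnW.
by move=> i ij; apply: hy; apply: ltnW.
Qed.

(** Since [T y = z - y], each iterate of [T] at [y] is the previous iterate at
    [z] minus the previous iterate at [y]; so [y] stays in [D] one step longer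
    than [z]. *)
Lemma iter_resolvent n y z : D y -> y + T y = z ->
  (forall j, (j < n)%N -> D (iter j T z)) ->
  forall j, (j <= n)%N -> D (iter j T y).
Proof.
move=> Dy yz hz j; elim/ltn_ind: j => -[//|j] IH jn.
have hy i : (i <= j)%N -> D (iter i T y).
  by move=> ij; apply: IH; rewrite ?ltnS // (leq_trans ij) // ltnW.
rewrite iterSr (_ : T y = z - y); last by rewrite -yz addrC addKr.
rewrite iterB.
- by apply: DB; [exact: hz|exact: hy].
- by move=> i ij; apply: hz; apply: ltn_trans ij jn.
- by move=> i ij; apply: hy; apply: ltnW.
Qed.

(** If [z] leaves [D] at step [n], then [y] with [y + T y = z] leaves it at step
    [n + 1]: [T^(n+1) y = T^n z - T^n y], where [T^n y] is in [D] and [T^n z] is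
    not. *)
Lemma exists_exit_time v n : V v -> ~ D v ->
  exists z, [/\ V z, forall j, (j < n)%N -> D (iter j T z) & ~ D (iter n T z)].
Proof.
move=> Vv Dv; elim: n => [|n [z [Vz hz Dz]]]; first by exists v.
have [y Dy yz] := surj Vz.
have hy := iter_resolvent Dy yz hz.
exists y; split => [||Dn]; [exact: DV|by []|apply: Dz].
have Tn : iter n.+1 T y = iter n T z - iter n T y.
  rewrite iterSr (_ : T y = z - y); last by rewrite -yz addrC addKr.
  by apply: iterB => // j jn; apply: hy; apply: ltnW.
have -> : iter n T z = iter n.+1 T y - (0 - iter n T y).
  by rewrite Tn sub0r opprK subrK.
apply: DB => //; apply: DB; last exact: hy.
by rewrite -(subrr y); apply: DB.
Qed.
End Iterates.

(** * Limits of sequences *)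

Lemma closure_lim (X : topologicalType) (C : set X) (c : nat -> X) (p : X) :
  (forall n, C (c n)) -> c n @[n --> \oo] --> p -> closure C p.
Proof.
move=> Cc; apply: (closed_cvg (closure C) (@closed_closure _ C)).
by apply: nearW => n; exact: subset_closure.
Qed.

Lemma cvg_of_tail_small (R : realType) (X : completeNormedModType R)
    (u : nat -> X) :
  (forall e : R, 0 < e -> exists N, forall n, (N <= n)%N -> `|u N - u n| < e) ->
  exists l : X, u n @[n --> \oo] --> l.
Proof.
move=> h; exists (lim (u n @[n --> \oo])).
apply: cauchy_cvg; apply: cauchy_exP => e e0.
have [N hN] := h e e0; exists (u N); exists N => //= n Nn.
by rewrite -ball_normE; exact: hN.
Qed.

(** * Inner products and orthogonal projections *)

Section InnerProduct.
Context {R : realType} {X : completeNormedModType R}.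
Variable ip : {dot X for idfun}.
Hypothesis ip_norm : norm_of_inner ip.

Lemma ipC u v : ip u v = ip v u.
Proof. by rewrite hermC expr0 mul1r. Qed.

Lemma ipDl u v w : ip (u + v) w = ip u w + ip v w.
Proof. exact: linearDl. Qed.

Lemma ipBl u v w : ip (u - v) w = ip u w - ip v w.
Proof. exact: linearBl. Qed.

Lemma ipDr u v w : ip w (u + v) = ip w u + ip w v.
Proof. exact: linearDr. Qed.

Lemma ipBr u v w : ip w (u - v) = ip w u - ip w v.
Proof. exact: linearBr. Qed.

Lemma ipZl a u v : ip (a *: u) v = a * ip u v.
Proof. exact: linearZl_LR. Qed.

Lemma ipZr a u v : ip u (a *: v) = a * ip u v.
Proof. by rewrite ipC ipZl ipC. Qed.

Lemma ip_ge0 u : 0 <= ip u u.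
Proof. by rewrite -ip_norm sqr_ge0. Qed.

Lemma ip_eq0 u : ip u u = 0 -> u = 0.
Proof. by rewrite -ip_norm => /eqP; rewrite sqrf_eq0 normr_eq0 => /eqP. Qed.

(** This transfers continuity from the norm to the inner product. *)
Lemma polarization u v : ip u v = (`|u + v| ^+ 2 - `|u - v| ^+ 2) / 4.
Proof. by rewrite !ip_norm ipDl ipBl !ipBr !ipDr (ipC v u); field. Qed.

Lemma cvg_ip (I : Type) (F : set_system I) {FF : Filter F} (u v : I -> X)
    (a b : X) : u n @[n --> F] --> a -> v n @[n --> F] --> b ->
  ip (u n) (v n) @[n --> F] --> ip a b.
Proof.
have cvg_sqr (w : I -> X) (c : X) : w n @[n --> F] --> c ->
    `|w n| ^+ 2 @[n --> F] --> `|c| ^+ 2.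
  by move=> wc; rewrite expr2; under eq_fun do rewrite expr2;
    apply: cvgM; apply: cvg_norm.
move=> ua vb; under eq_fun do rewrite polarization.
rewrite polarization; apply: cvgMl; apply: cvgB; apply: cvg_sqr.
  exact: cvgD.
exact: cvgB.
Qed.

Lemma closed_orthogonal (w : X) : closed [set v | ip w v = 0].
Proof.
have /continuous_closedP cont : continuous (ip w : X -> R).
  by move=> v; apply: cvg_ip => //; exact: cvg_cst.
exact: (cont [set x | x = 0] (@closed_eq R 0)).
Qed.

Definition subspace (C : set X) : Prop :=
  C 0 /\ forall (a : R) x y, C x -> C y -> C (a *: x + y).

(** The parallelogram identity for [x - u] and [x - v], solved for [u - v]: when
    both points almost realize the distance from [x] to a convex set containing
    their midpoint, they are close to each other. *)
Lemma parallelogram (x u v : X) :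
  `|u - v| ^+ 2 = 2 * `|x - u| ^+ 2 + 2 * `|x - v| ^+ 2
                  - 4 * `|x - (2^-1 *: u + 2^-1 *: v)| ^+ 2.
Proof.
rewrite !ip_norm !ipBl !ipBr !ipDl !ipDr !ipZl !ipZr.
by rewrite (ipC u x) (ipC v x) (ipC v u); field.
Qed.

(** A minimizing sequence for the distance from [x] to [C] is Cauchy, and its
    limit still minimizes the distance along every line of direction [v] in [C],
    so [x - p] is orthogonal to [v].  The sequence is part of the conclusion
    because [minty] lifts it to a sequence in the graph. *)
Lemma exists_orthproj (C : set X) (x : X) : subspace C ->
  exists c : nat -> X, exists p : X,
  [/\ forall n, C (c n), c n @[n --> \oo] --> p &
      forall v : X, C v -> ip (x - p) v = 0].
Proof.
move=> [C0 Clin].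
pose E := [set `|x - c| ^+ 2 | c in C].
have infE : has_inf E.
  split; first by exists (`|x - 0| ^+ 2); exists 0.
  by exists 0 => _ [c _ <-]; rewrite sqr_ge0.
pose d := inf E.
have dlb c : C c -> d <= `|x - c| ^+ 2.
  by move=> Cc; apply: ge_inf; [case: infE|exists c].
have /choice[c hc] (n : nat) : exists c, C c /\ `|x - c| ^+ 2 < d + n.+1%:R^-1.
  have [|_ [c Cc <-] lt] := @inf_adherent _ E n.+1%:R^-1 _ infE.
    by rewrite invr_gt0.
  by exists c.
have [p cp] : exists p : X, c n @[n --> \oo] --> p.
  apply: cvg_of_tail_small => e e0.
  have e4 : 0 < e ^+ 2 / 4 by rewrite divr_gt0 ?exprn_gt0.
  have [N _ hN] := near_infty_natSinv_lt (PosNum e4).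
  have {}hN n : (N <= n)%N -> n.+1%:R^-1 < e ^+ 2 / 4 by exact: hN.
  exists N => n Nn.
  rewrite -(ltr_pXn2r (n := 2)) ?nnegrE ?(ltW e0) // (parallelogram x).
  have [CN HN] := hc N; have [Cn Hn] := hc n.
  have Cm : C (2^-1 *: c N + 2^-1 *: c n).
    by apply: (Clin) => //; rewrite -[_ *: _]addr0; apply: Clin.
  move: (dlb _ Cm) (hN N (leqnn N)) (hN n Nn) HN Hn.
  (* Only the upper bounds of the two reciprocals are used from here on. *)
  move: (N.+1%:R^-1) (n.+1%:R^-1) => a b; lra.
exists c, p; split=> // [n|v Cv]; first by case: (hc n).
have orth_ge t : d <= ip (x - (p + t *: v)) (x - (p + t *: v)).
  have h : ip (x - (c n + t *: v)) (x - (c n + t *: v)) @[n --> \oo] -->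
    ip (x - (p + t *: v)) (x - (p + t *: v)).
    by apply: cvg_ip; apply: cvgB; [exact: cvg_cst| |exact: cvg_cst|];
      apply: cvgD => //; exact: cvg_cst.
  apply: (cvgr_to_ge h); apply: nearW => n.
  rewrite -ip_norm; apply: dlb; rewrite addrC; apply: Clin => //.
  by case: (hc n).
have le_d : ip (x - p) (x - p) <= d.
  have h : d + n.+1%:R^-1 @[n --> \oo] --> d.
    rewrite -[X in _ --> X]addr0; apply: cvgD; first exact: cvg_cst.
    exact: cvg_harmonic.
  have h' : ip (x - c n) (x - c n) @[n --> \oo] --> ip (x - p) (x - p).
    by apply: cvg_ip; apply: cvgB => //; exact: cvg_cst.
  apply: (ler_cvg_to h' h); apply: nearW => n.
  by rewrite -ip_norm; apply: ltW; case: (hc n).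
apply: (quadratic_ge0_slope0 (ip_ge0 v)) => t.
have := orth_ge t; rewrite opprD addrA.
move: (x - p) le_d => w le_d; rewrite !ipBl !ipBr !ipZl !ipZr (ipC v w); lra.
Qed.

(** The closure of a subspace is its double orthogonal, which shows that it is
    again a subspace and that vectors orthogonal to [C] are orthogonal to its
    closure. *)
Lemma closure_subspaceE (C : set X) : subspace C ->
  closure C =
  [set x | forall w : X, (forall v : X, C v -> ip w v = 0) -> ip w x = 0].
Proof.
move=> Csub; rewrite eqEsubset; split => [x Cx w Cw|x hx].
  apply: (closed_orthogonal (w := w)); apply: (closureS _ Cx).
  by move=> v /Cw.
have [c [p [Cc cp orth]]] := exists_orthproj x Csub.
have clp := closure_lim Cc cp.
suff /eqP : x - p = 0 by rewrite subr_eq0 => /eqP ->.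
apply: ip_eq0; rewrite ipBr (hx _ orth) sub0r.
have := closureS (B := [set v | ip (x - p) v = 0]) orth clp.
by move=> /(closed_orthogonal (w := x - p)) /= ->; rewrite oppr0.
Qed.

Lemma orthproj_closure (C : set X) (x : X) : subspace C ->
  closure C (orthproj ip (closure C) x) /\
  forall v, C v -> ip (x - orthproj ip (closure C) x) v = 0.
Proof.
move=> Csub; rewrite /orthproj; case: xgetP => [p _ [clp orth]|none].
  by split=> // v Cv; apply: orth; exact: subset_closure.
have [c [p [Cc cp orth]]] := exists_orthproj x Csub.
case: (none p); split; first exact: closure_lim cp.
move=> v; rewrite closure_subspaceE //; exact.
Qed.

Lemma orthproj_closure_eq (C : set X) (x p : X) : subspace C -> closure C p ->
  (forall v, C v -> ip (x - p) v = 0) -> orthproj ip (closure C) x = p.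
Proof.
move=> Csub; have [] := orthproj_closure x Csub.
set q := orthproj _ _ _; rewrite closure_subspaceE //= => clq xq clp xp.
have orth v : C v -> ip (q - p) v = 0.
  by move=> Cv; have := xp v Cv; have := xq v Cv; rewrite !ipBl; lra.
apply/eqP; rewrite -subr_eq0; apply/eqP; apply: ip_eq0.
by rewrite ipBr clq // clp // subrr.
Qed.

(** * Maximal monotone linear relations *)

Section MaximalMonotone.
Variable A : X -> set X.
Hypothesis A_max : maximal_monotone ip A.

Lemma maximal_monotone_mem (x u : X) :
  (forall a b, A a b -> 0 <= ip (x - a) (u - b)) -> A x u.
Proof.
move=> h; case: A_max => mon max.
pose B z := A z `|` [set w | z = x /\ w = u].
suff eqB : gra B = gra A.
  have : gra B (x, u) by right.
  by rewrite eqB.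
apply: max; last by move=> p Ap; left.
move=> [a b] [a' b'] [Ab|/= [-> ->]] [Ab'|/= [-> ->]].
- exact: mon Ab Ab'.
- by have := h _ _ Ab; rewrite /= !ipBl !ipBr; lra.
- exact: h.
- by rewrite /= !subrr ip_ge0.
Qed.

Hypothesis A_lin : linear_relation A.

Lemma linear_relation_comb (a : R) x y u v :
  A x u -> A y v -> A (a *: x + y) (a *: u + v).
Proof.
case: A_lin => -[_ lin] scal add Axu Ayv.
have Aau : A (a *: x) (a *: u) by apply: scal; [exists u|exists u].
apply: add; [by exists (a *: u)|by exists v|].
by exists (a *: u) => //; exists v.
Qed.

Lemma linear_relationB x y u v : A x u -> A y v -> A (x - y) (u - v).
Proof.
move=> Axu Ayv; have := linear_relation_comb (-1) Ayv Axu.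
by rewrite !scaleN1r addrC (addrC (- v)).
Qed.

Lemma linear_relation0 : A 0 0.
Proof.
case: A_lin => -[]; rewrite in_setE => -[u A0u] _ _ _.
by have := linear_relationB A0u A0u; rewrite !subrr.
Qed.

Lemma dom_subspace : subspace (dom A).
Proof.
split=> [|a x y [u Axu] [v Ayv]]; first by exists 0; exact: linear_relation0.
by exists (a *: u + v); exact: linear_relation_comb.
Qed.

Lemma fiber0_orthogonal u x : A 0 u -> dom A x -> ip u x = 0.
Proof.
move=> A0u [v Axv]; apply: (@affine_ge0_slope0 _ _ (ip v x)) => t.
have A0t : A 0 (t *: u).
  have := linear_relation_comb t A0u linear_relation0.
  by rewrite scaler0 !addr0.
have := A_max.1 (x, v) (0, t *: u) Axv A0t.
by rewrite /= subr0 ipBr ipZr ipC (ipC x u).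
Qed.

(** For [(a, b)] in the graph, [<w - a, w - b> = <w, w> - <w, a + b> + <a, b>]
    is nonnegative, so maximality puts [(w, w)] in the graph; then [w] is
    orthogonal to [w + w]. *)
Lemma range_orthogonal0 w :
  (forall a b, A a b -> ip w (a + b) = 0) -> w = 0.
Proof.
move=> orth; have Aww : A w w.
  apply: maximal_monotone_mem => a b Aab.
  have := A_max.1 (a, b) (0, 0) Aab linear_relation0; rewrite /= !subr0.
  have := orth _ _ Aab; move: (ip_ge0 w).
  rewrite ipBl !ipBr !ipDr (ipC a w); lra.
by apply: ip_eq0; have := orth _ _ Aww; rewrite ipDr; lra.
Qed.

(** The surjectivity half of Minty's theorem. *)
Lemma minty y : exists x u, A x u /\ x + u = y.
Proof.
pose Rg := [set y | exists x u, A x u /\ x + u = y].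
have Rg_sub : subspace Rg.
  split=> [|a _ _ [x [u [Axu <-]]] [x' [u' [Axu' <-]]]].
    by exists 0, 0; split; [exact: linear_relation0|rewrite addr0].
  exists (a *: x + x'), (a *: u + u'); split; first exact: linear_relation_comb.
  by rewrite scalerDr addrACA.
(* The range is dense: [y] is a limit of points [c n = x n + u n]. *)
have [c [p [Rc cp orth]]] := exists_orthproj y Rg_sub.
have yp : y = p.
  apply/eqP; rewrite -subr_eq0; apply/eqP; apply: range_orthogonal0 => a b Aab.
  by apply: orth; exists a, b.
(* The inverse of the identity plus [A] is nonexpansive, so [x n] converges. *)
have /choice[x /choice[u hxu]] := Rc.
have x_dist n m : `|x n - x m| <= `|c n - c m|.
  have [An <-] := hxu n; have [Am <-] := hxu m.
  rewrite -(ler_pXn2r (n := 2)) ?nnegrE // !ip_norm opprD addrACA.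
  have := A_max.1 (x n, u n) (x m, u m) An Am => /=.
  move: (x n - x m) (u n - u m) => s t.
  rewrite ipDl !ipDr (ipC t s); move: (ip_ge0 t); lra.
have [q xq] : exists q : X, x n @[n --> \oo] --> q.
  apply: cvg_of_tail_small => e e0.
  have e2 : 0 < e / 2 by rewrite divr_gt0.
  have [N _ hN] := cvgr_dist_lt c p cp _ e2.
  exists N => n Nn; apply: le_lt_trans (x_dist _ _) _.
  rewrite (splitr e); apply: le_lt_trans (ler_distD p _ _) _.
  by apply: ltrD; [rewrite distrC|]; apply: hN => //=.
(* The limit [(q, y - q)] of the graph points is in the graph by maximality. *)
exists q, (y - q); split; last by rewrite addrC subrK.
apply: maximal_monotone_mem => a b Aab.
have h : ip (x n - a) (c n - x n - b) @[n --> \oo] --> ip (q - a) (y - q - b).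
  rewrite yp; apply: cvg_ip; apply: cvgB; try exact: cvg_cst.
    exact: xq.
  exact: cvgB.
apply: (cvgr_to_ge h); apply: nearW => n; have [Axu <-] := hxu n.
by rewrite (addrC (x n) (u n)) addrK; exact: (A_max.1 (x n, u n) (a, b)).
Qed.

End MaximalMonotone.

End InnerProduct.

(** * The projected operator *)

Section ProjectedOperator.
Context {R : realType} {X : completeNormedModType R}.
Variables (ip : {dot X for idfun}) (A : X -> set X).
Hypotheses (ip_norm : norm_of_inner ip) (A_max : maximal_monotone ip A).
Hypothesis A_lin : linear_relation A.
Let V := closure (dom A).
Let D_sub := dom_subspace A_lin.

(** A total function, so that it can be iterated on points; it agrees with the
    projected operator on [dom A]. *)
Definition proj_val (z : X) : X := orthproj ip V (xget 0 (A z)).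

Lemma proj_op_single z u : A z u -> proj_op ip V A z = [set orthproj ip V u].
Proof.
move=> Azu; rewrite eqEsubset; split=> [_ [v Azv <-]|_ ->]; last by exists u.
have [clp up] := orthproj_closure ip_norm u D_sub.
apply: orthproj_closure_eq => // x Dx.
have A0 : A 0 (v - u).
  by rewrite -(subrr z); apply: linear_relationB.
have := fiber0_orthogonal A_max A_lin A0 Dx.
by have := up x Dx; rewrite !(ipBl ip); lra.
Qed.

Lemma proj_valE z u : A z u -> proj_val z = orthproj ip V u.
Proof.
move=> Azu; have : proj_op ip V A z (proj_val z).
  by exists (xget 0 (A z)) => //; apply: (xgetPex 0); exists u.
by rewrite (proj_op_single Azu).
Qed.

Lemma proj_opE z : dom A z -> proj_op ip V A z = [set proj_val z].
Proof. by move=> [u Azu]; rewrite (proj_op_single Azu) (proj_valE Azu). Qed.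

Lemma dom_subr x y : dom A x -> dom A y -> dom A (x - y).
Proof.
by move=> [u Axu] [v Ayv]; exists (u - v); apply: linear_relationB.
Qed.

Lemma proj_valB x y : dom A x -> dom A y ->
  proj_val (x - y) = proj_val x - proj_val y.
Proof.
move=> [u Axu] [v Ayv].
have Auv := linear_relationB A_lin Axu Ayv.
rewrite (proj_valE Axu) (proj_valE Ayv) (proj_valE Auv).
have [clu hu] := orthproj_closure ip_norm u D_sub.
have [clv hv] := orthproj_closure ip_norm v D_sub.
apply: orthproj_closure_eq => //; last first.
  by move=> z Dz; have := hu z Dz; have := hv z Dz; rewrite !(ipBl ip); lra.
move: clu clv; rewrite /V (closure_subspaceE ip_norm D_sub) /= => clu clv w hw.
by rewrite ipBr clu // clv // subrr.
Qed.

(** Decompose [v = y + u] with [u] in [A y] by [minty] and project: [y] and [v]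
    are in [V], hence so is [u], which is its own projection. *)
Lemma resolvent_surj v : V v -> exists2 y, dom A y & y + proj_val y = v.
Proof.
move=> Vv; have [y [u [Ayu yuv]]] := minty ip_norm A_max A_lin v.
have Dy : dom A y by exists u.
exists y => //; rewrite (proj_valE Ayu).
have -> : orthproj ip V u = v - y; last by rewrite addrC subrK.
apply: orthproj_closure_eq => //; last first.
  by move=> x _; rewrite -yuv (addrC y) addrK subrr linear0l.
move: Vv; rewrite /V (closure_subspaceE ip_norm D_sub) /= => Vv w hw.
by rewrite ipBr Vv // hw // subrr.
Qed.

Lemma op_iter_proj z m : (forall j, (j < m)%N -> dom A (iter j proj_val z)) ->
  op_iter (proj_op ip V A) m z = [set iter m proj_val z].
Proof.
rewrite /op_iter; elim: m => //= m IH h.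
rewrite IH => [|j jm]; last by apply: h; apply: ltnW.
by rewrite bigcup_set1 proj_opE //; apply: h.
Qed.

End ProjectedOperator.

Unset Implicit Arguments.

Theorem proposition4p12 (R : realType) (X : completeNormedModType R)
    (ip : {dot X for idfun}) (ip_norm : norm_of_inner ip)
    (A : X -> set X) (A_maxmon : maximal_monotone ip A)
    (A_lin : linear_relation A) (domA_nclosed : ~ closed (dom A)) :
  let V := closure (dom A) in
  let PA := proj_op ip V A in
  (forall z, dom A z -> exists w, PA z = [set w]) /\
  exists z_ : nat -> X, forall n, (1 <= n)%N ->
    [/\ dom A (z_ n),
        forall m, (1 <= m < n)%N -> value_in (op_iter PA m (z_ n)) (dom A) &
        value_in (op_iter PA n (z_ n)) (~` dom A)].
Proof.
move=> V PA; split=> [z Dz|].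
  by exists (proj_val ip A z); exact: proj_opE.
have [v Vv Dv] : exists2 v, V v & ~ dom A v.
  apply: contra_notP domA_nclosed => none v Vv.
  by apply: contrapT => Dv; apply: none; exists v.
have /choice[z_ hz] := fun n => exists_exit_time (dom_subr A_lin)
  (proj_valB ip_norm A_maxmon A_lin) (@subset_closure _ (dom A))
  (resolvent_surj ip_norm A_maxmon A_lin) n Vv Dv.
exists z_ => n n0; have [_ hD hnD] := hz n.
have iterE m : (m <= n)%N ->
    op_iter PA m (z_ n) = [set iter m (proj_val ip A) (z_ n)].
  move=> mn; apply: op_iter_proj => // j jm.
  by apply: hD; apply: leq_trans jm mn.
split; first exact: hD n0.
- move=> m /andP[_ mn]; exists (iter m (proj_val ip A) (z_ n)).
    exact/iterE/ltnW.
  exact: hD.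
- by exists (iter n (proj_val ip A) (z_ n)); [exact: iterE|].
Qed.
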